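(* (a) Let $\sigma>0$ and $\mathcal B_\sigma=\{f\in\mathcal W^{2,\infty}:\|f''\|_\infty\le\sigma\}$. Let $A$ be the non-adaptive linear spline algorithm on $\mathcal B_\sigma$ defined in the context. Then for every $\varepsilon>0$ and $f\in\mathcal B_\sigma$, $\|f-A(f,\varepsilon)\|_\infty\le\varepsilon$, and the cost of this algorithm is $\bigl\lceil\sqrt{\sigma/(8\varepsilon)}\,\bigr\rceil+1$, regardless of the size of $\|f''\|_\infty$. (b) Let $\tau\ge2$ and let $A$ be the adaptive linear spline algorithm with initial cone constant $\tau$ defined in the context. Then for every $\varepsilon>0$ and $f\in\mathcal C_\tau$, $\|f-A(f,\varepsilon)\|_\infty\le\varepsilon$. Moreover, the cost is bounded as follows: $$\max\!\left(\left\lceil\tfrac{\tau+1}{2}\right\rceil,\left\lceil\sqrt{\tfrac{\|f''\|_\infty}{8\varepsilon}}\,\right\rceil\right)+1\le\max\!\left(\left\lceil\tfrac{\tau+1}{2}\right\rceil,\left\lceil\sqrt{\tfrac{\tau\|f'-f(1)+f(0)\|_\infty}{8\varepsilon}}\,\right\rceil\right)+1\le\operatorname{cost}(A,f,\varepsilon)$$ $$\le\sqrt{\frac{\tau\|f'-f(1)+f(0)\|_\infty}{2\varepsilon}}+\tau+4\le\sqrt{\frac{\tau\|f''\|_\infty}{4\varepsilon}}+\tau+4 .$$ The algorithm is computationally stable: for each of the two functionals $|f|_*=\|f'-f(1)+f(0)\|_\infty$ and $|f|_*=\|f''\|_\infty$, $$\sup_{\varepsilon,s>0}\frac{\sup\{\operatorname{cost}(A,f,\varepsilon):f\in\mathcal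 C_\tau,\ |f|_*\le s\}}{\max\bigl(1,\inf\{\operatorname{cost}(A,f,\varepsilon):f\in\mathcal C_\tau,\ |f|_*\ge s\}\bigr)}<\infty .$$
   Context: **Spaces.** $\mathcal W^{2,\infty}=\{f\in C[0,1]:\|f''\|_\infty<\infty\}$ is the Sobolev space on $[0,1]$ (i.e. $f$ is differentiable with Lipschitz $f'$, and $f''$ is defined almost everywhere); $\|\cdot\|_\infty$ is the (essential) supremum norm on $[0,1]$. In $\|f'-f(1)+f(0)\|_\infty$ the number $f(1)-f(0)$ is subtracted as a constant function. For $\tau>0$, $\mathcal C_\tau=\{f\in\mathcal W^{2,\infty}:\|f''\|_\infty\le\tau\|f'-f(1)+f(0)\|_\infty\}$. **Cost.** The cost of an algorithm is the number of function values of $f$ it uses. **Linear spline and auxiliary quantities.** For $n\ge2$ let $x_i=(i-1)/(n-1)$, $i=1,\dots,n$, and $$A_n(f)(x)=(n-1)\bigl[f(x_i)(x_{i+1}-x)+f(x_{i+1})(x-x_i)\bigr]\quad\text{for }x_i\le x\le x_{i+1},$$ $$\widetilde F_n(f)=\sup_{i=1,\dots,n-1}\bigl|(n-1)[f(x_{i+1})-f(x_i)]-f(1)+f(0)\bigr|,$$ $$F_n(f)=(n-1)^2\sup_{i=1,\dots,n-2}|f(x_i)-2f(x_{i+1})+f(x_{i+2})| .$$ **Non-adaptive algorithm on $\mathcal B_\sigma$.** With $h(n)=1/(8(n-1)^2)$, $n\ge2$, choose $n=\min\{k\ge2:h(k)\le\varepsilon/\sigma\}$ and return $A(f,\varepsilon)=A_n(f)$.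 **Adaptive algorithm.** Let $\tau\ge2$ be the cone constant, $i=1$, $n_1=\lceil(\tau+1)/2\rceil+1$. For $\varepsilon>0$ and input $f$: - Stage 1. Compute $\widetilde F_{n_i}(f)$ and $F_{n_i}(f)$. - Stage 2. Compute $\tau_{\min,n_i}=F_{n_i}(f)/\bigl(\widetilde F_{n_i}(f)+F_{n_i}(f)/(2n_i-2)\bigr)$ (with $0/0=0$). If $\tau\ge\tau_{\min,n_i}$ go to Stage 3. Otherwise replace $\tau$ by $2\tau_{\min,n_i}$; then if $n_i\ge(\tau+1)/2$ go to Stage 3; otherwise set $n_{i+1}=1+(n_i-1)\lceil(\tau+1)/(2n_i-2)\rceil$, increase $i$ by 1, and go to Stage 1. - Stage 3. If $\widetilde F_{n_i}(f)\le 4\varepsilon(n_i-1)(2n_i-2-\tau)/\tau$, return $A(f,\varepsilon)=A_{n_i}(f)$ and stop. Otherwise set $$n_{i+1}=1+(n_i-1)\max\left\{2,\left\lceil\frac1{n_i-1}\sqrt{\frac{\tau\widetilde F_{n_i}(f)}{8\varepsilon}}\,\right\rceil\right\},$$ increase $i$ by 1, and go to Stage 1. Since the nodes are nested, $\operatorname{cost}(A,f,\varepsilon)$ is the final value $n_i$. In the claim, $\tau$ denotes the initial cone constant. The infimum of the empty set is $+\infty$ (and a finite number divided by $+\infty$ is $0$). *)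

(* Defs.v *)
(* Written in the MathComp / MathComp-Analysis world. *)
From HB Require Import structures.
From mathcomp Require Import all_boot all_order all_algebra.
From mathcomp Require Import all_classical all_reals all_analysis.

Set Implicit Arguments.
Unset Strict Implicit.
Unset Printing Implicit Defensive.

Import Order.TTheory GRing.Theory Num.Theory.
Import numFieldNormedType.Exports.

Local Open Scope ring_scope.
Local Open Scope classical_set_scope.

Section Spaces.
Context {R : realType}.
Implicit Types (f g : R -> R) (sigma tau : R).

(* Functions on [0,1] are represented by functions R -> R of which only the
   values on [0,1] matter. *)

(* Essential supremum of |g| on [0,1]: g is set to 0 outside [0,1], which does
   not affect the essential supremum of the absolute value. *)
Definition Linfty g : \bar R :=
  Lnorm (@lebesgue_measure R) +oo%E ((EFin \o g) \_ `[0, 1]).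

Definition norm_slope f : \bar R := Linfty (fun x => (f^`())%classic x - f 1 + f 0).
Definition norm_d2 f : \bar R := Linfty f^`(2).

(* Differentiability at the endpoints (one-sided, the only kind that makes
   sense on [0,1]) is implied: f is continuous on [0,1] and f' is Lipschitz,
   hence extends continuously to [0,1]. For x inside ]0,1[, [f^`() x] and
   [f^`(2) x] only depend on f on [0,1]; their values at the endpoints are
   irrelevant to all the norms. The third clause says that f'' is defined
   almost everywhere ([f^`(2) x] is a default value where it is not); it follows
   from the second one by Rademacher's theorem. On this space both
   [norm_slope f] and [norm_d2 f] are finite. *)
Definition W2infty : set (R -> R) := [set f |
  [/\ derivable_oo_LRcontinuous f 0 1,
      [lipschitz f^`() x | x in `]0, 1[],
      \forall x \ae (@lebesgue_measure R),
        `]0, 1[ x -> derivable f^`() x 1 &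
      (norm_d2 f < +oo)%E]].

Definition ball_d2 sigma : set (R -> R) :=
  [set f | W2infty f /\ (norm_d2 f <= sigma%:E)%E].

Definition cone tau : set (R -> R) :=
  [set f | W2infty f /\ (norm_d2 f <= tau%:E * norm_slope f)%E].

End Spaces.

Section Spline.
Context {R : realType}.
Implicit Types (f : R -> R) (n i : nat).

(* Nodes are numbered from 0: [node n i] is x_{i+1} = i/(n-1), 0 <= i < n. *)
Definition node n i : R := i%:R / (n%:R - 1).
Definition nodes n : seq R := [seq node n i | i <- iota 0 n].

(* i is the index of a subinterval [x_i, x_{i+1}] containing x in [0,1]; the
   cap at n - 2 puts x = 1 in the last one. *)
Definition spline n f (x : R) : R :=
  let i := minn (Num.truncn (x * (n%:R - 1))) (n - 2) in
  (n%:R - 1) * (f (node n i) * (node n i.+1 - x)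
                + f (node n i.+1) * (x - node n i)).

Definition Ftilde n f : R :=
  \big[Num.max/0]_(0 <= i < n - 1)
    `| (n%:R - 1) * (f (node n i.+1) - f (node n i)) - f 1 + f 0 |.

Definition Fhat n f : R :=
  (n%:R - 1) ^+ 2 * \big[Num.max/0]_(0 <= i < n - 2)
    `| f (node n i) - 2 * f (node n i.+1) + f (node n i.+2) |.

End Spline.

Section Algorithms.
Context {R : realType}.
Implicit Types (f : R -> R) (sigma tau eps : R) (n k : nat).

(* Outcome of running an algorithm on f: the points at which it looked up f
   (in order, possibly with repetitions) and the approximation returned. *)
Record result := Result { samples : seq R ; output : R -> R }.

(* A value of f needed several times is looked up only once. *)
Definition ncost (r : result) : nat := size (undup (samples r)).

Definition hn n : R := (8 * (n%:R - 1) ^+ 2)^-1.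

Definition nonadaptive_n sigma eps : nat :=
  xget 0%N [set n | [/\ (2 <= n)%N, hn n <= eps / sigma &
    forall k, (2 <= k)%N -> hn k <= eps / sigma -> (n <= k)%N]].

Definition nonadaptive sigma eps f : result :=
  let n := nonadaptive_n sigma eps in Result (nodes n) (spline n f).

(* For x >= 0. *)
Definition ceiln (x : R) : nat := `|Num.ceil x|%N.

(* x / 0 = 0 in MathComp, which covers 0 / 0 = 0. *)
Definition tau_min n f : R :=
  Fhat n f / (Ftilde n f + Fhat n f / (2 * n%:R - 2)).

(* [Next tau n]: go to Stage 1 with cone constant tau and n nodes;
   [Return]: return the spline on the current nodes. *)
Inductive action := Next of R & nat | Return.

Definition stage3 eps f tau n : action :=
  if Ftilde n f <= 4 * eps * (n%:R - 1) * (2 * n%:R - 2 - tau) / tau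
  then Return
  else Next tau (1 + (n - 1) *
         maxn 2 (ceiln ((n%:R - 1)^-1
                        * Num.sqrt (tau * Ftilde n f / (8 * eps)))))%N.

Definition stage2 eps f tau n : action :=
  if tau_min n f <= tau then stage3 eps f tau n
  else let tau' := 2 * tau_min n f in
    if (tau' + 1) / 2 <= n%:R then stage3 eps f tau' n
    else Next tau' (1 + (n - 1) * ceiln ((tau' + 1) / (2 * n%:R - 2)))%N.

(* At most k passes through Stage 1; None if the algorithm has not returned
   by then. *)
Fixpoint adaptive_iter k eps f tau n : option result :=
  if k is k'.+1 then
    match stage2 eps f tau n with
    | Return => Some (Result (nodes n) (spline n f))
    | Next tau' n' =>
        omap (fun r => Result (nodes n ++ samples r) (output r))
             (adaptive_iter k' eps f tau' n')
    end
  else None.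

(* The outcome of the algorithm, None if it never returns. Any k for which
   [adaptive_iter] succeeds gives the same result. *)
Definition adaptive tau eps f : option result :=
  let run k := adaptive_iter k eps f tau (ceiln ((tau + 1) / 2) + 1)%N in
  run (xget 0%N [set k | run k]).

Definition adaptive_cost tau eps f : \bar R :=
  if adaptive tau eps f is Some r then (ncost r)%:R%:E else +oo%E.

End Algorithms.

(* Supremum, over eps and s, of the ratio defining computational stability.
   In \bar R, the infimum of the empty set is +oo and +oo^-1 = 0. *)
Definition stability_sup {R : realType} (C : set (R -> R))
    (cost : R -> (R -> R) -> \bar R) (seminorm : (R -> R) -> \bar R) : \bar R :=
  ereal_sup [set q | exists eps s : R, [/\ 0 < eps, 0 < s &
    q = (ereal_sup [set cost eps f | f in
                     [set f | C f /\ (seminorm f <= s%:E)%E]]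
         / Order.max 1 (ereal_inf [set cost eps f | f in
                     [set f | C f /\ (s%:E <= seminorm f)%E]]))%E]].

(* Main.v *)
Require Import Defs.
From HB Require Import structures.
From mathcomp Require Import all_boot all_order all_algebra.
From mathcomp Require Import all_classical all_reals all_analysis ess_sup_inf measurable_realfun.
From mathcomp Require Import ring lra.

Set Implicit Arguments.
Unset Strict Implicit.
Unset Printing Implicit Defensive.

Import Order.TTheory GRing.Theory Num.Theory.
Import numFieldNormedType.Exports.

Local Open Scope ring_scope.
Local Open Scope classical_set_scope.

(* On W^{2,oo} the derivative f' is Lipschitz with constant D = ||f''||_oo, so
   Taylor's formula bounds the spline error by D / (8 (n-1)^2), the difference
   between f' and a secant slope on a mesh cell by D / (2 (n-1)), and F_n by D.
   Writing S for ||f' - f(1) + f(0)||_oo, this gives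
     Ftilde_n <= S <= Ftilde_n + D / (2 (n-1)).
   On the cone D <= tau S, so tau_min,n <= tau and tau is never updated, and
   S (2n - 2 - tau) <= (2n - 2) Ftilde_n: the stopping test forces
   tau S <= 8 eps (n-1)^2, which gives both the error bound and the lower cost
   bound. If the test fails with m = n - 1, then m (m - tau / 2) < tau S / (8 eps),
   hence m < tau / 2 + Q where Q^2 = tau S / (8 eps); both alternatives for the next mesh
   then have at most 2 Q + tau cells. *)

(** * Essential bounds and the growth of Lipschitz functions *)

Section Linfty.
Context {R : realType}.
Implicit Types (g : R -> R) (M : R).
Local Notation mu := (@lebesgue_measure R).

(** The norm of exponent +oo is an essential supremum only when the whole space has positive
    measure; here it contains the unit interval, of measure 1. *)
Lemma LinftyE g : Linfty g = ess_sup mu (abse \o ((EFin \o g) \_ `[0, 1])).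
Proof.
rewrite /Linfty unlock; case: ifPn => // /negP[].
apply: (@lt_le_trans _ _ (mu `[0, 1])).
  by rewrite lebesgue_measure_itv /= lte_fin ltr01 -EFinB lte_fin subr0.
by apply: le_measure; rewrite ?inE//; exact: measurableT.
Qed.

Lemma Linfty_ge0 g : (0 <= Linfty g)%E.
Proof. exact: Lnorm_ge0. Qed.

(** The endpoints, where derivatives are meaningless, form a null set; [0 <= M] handles the zero
    extension outside [[0, 1]]. *)
Lemma Linfty_le g M : 0 <= M -> (forall x, x \in `]0, 1[%R -> `|g x| <= M) ->
  (Linfty g <= M%:E)%E.
Proof.
move=> M0 gM; rewrite LinftyE; apply/ess_supP.
exists [set 0; 1]; split.
- by apply: measurableU; exact: measurable_set1.
- apply/eqP; rewrite eq_le measure_ge0 andbT.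
  apply: (le_trans (measureU2 _ _ _)); try exact: measurable_set1.
  by rewrite -[leRHS]adde0; apply: leeD; rewrite le_eqVlt; apply/orP; left;
    apply/eqP; exact: lebesgue_measure_set1.
move=> x /= /negP; rewrite -ltNge patchE; case: ifPn => [|_].
  move=> /set_mem /=; rewrite in_itv /= => /andP[].
  rewrite le_eqVlt => /predU1P[<-|x0]; first by left.
  rewrite le_eqVlt => /predU1P[->|x1]; first by right.
  by rewrite lte_fin ltNge gM// in_itv /= x0 x1.
by rewrite /point /= normr0 lte_fin ltNge M0.
Qed.

Lemma Linfty_ae g : (Linfty g < +oo)%E ->
  \forall x \ae mu, x \in `]0, 1[%R -> `|g x| <= fine (Linfty g).
Proof.
move=> goo; have gfin : Linfty g \is a fin_num by rewrite ge0_fin_numE ?Linfty_ge0.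
have := ess_sup_ge mu (abse \o ((EFin \o g) \_ `[0, 1])).
rewrite -LinftyE; apply: filterS => x; rewrite /= patchE.
move=> + x01; rewrite mem_set /=; last exact: subset_itv_oo_cc.
by rewrite -{1}(fineK gfin) lee_fin.
Qed.

(** A nonempty open interval has positive measure, so it cannot lie inside the exceptional null
    set. *)
Lemma ae_itvoo (P : R -> Prop) (a b : R) : a < b ->
  (\forall x \ae mu, P x) -> exists2 x, x \in `]a, b[%R & P x.
Proof.
move=> ab [N [mN N0 PN]]; apply: contrapT => noP.
have : (mu `]a, b[ <= mu N)%E.
  apply: le_measure; rewrite ?inE//.
  by move=> x /= xab; apply: PN => Px; apply: noP; exists x.
by rewrite N0 lebesgue_measure_itv /= lte_fin ab -EFinB lee_fin leNgt subr_gt0 ab.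
Qed.

End Linfty.

Section AeDerivative.
Context {R : realType}.
Implicit Types (g phi : R -> R) (a b C K M : R).
Local Notation mu := (@lebesgue_measure R).

(** Take the supremum s of the points t with [phi t <= phi a]. The one-sided Lipschitz bound carries
    the inequality to s, and descent to the right of s contradicts its maximality unless s = b. *)
Lemma le_of_right_descent phi a b C : a <= b -> 0 <= C ->
  (forall x y, a <= x -> x <= y -> y <= b -> phi y <= phi x + C * (y - x)) ->
  (forall x, a <= x -> x < b -> exists y, [/\ x < y, y <= b & phi y <= phi x]) ->
  phi b <= phi a.
Proof.
move=> ab C0 phiC phid.
pose A := [set t | [/\ a <= t, t <= b & phi t <= phi a]].
have Aa : A a by split.
have hA : has_sup A by split; [exists a|exists b => t []].
have as_ : a <= sup A by apply: sup_upper_bound.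
have sb : sup A <= b by apply: ge_sup; [exists a|move=> t []].
have phis : phi (sup A) <= phi a.
  apply/ler_addgt0Pr => e e0.
  have e1 : 0 < e / (C + 1) by rewrite divr_gt0// ltr_wpDl.
  have [t [at_ tb pt] st] := sup_adherent e1 hA.
  have ts : t <= sup A by apply: sup_upper_bound.
  apply: le_trans (phiC _ _ at_ ts sb) _; apply: lerD => //.
  have -> : e = (C + 1) * (e / (C + 1)).
    by rewrite mulrC divfK// gt_eqF// ltr_wpDl.
  by apply: ler_pM; rewrite ?subr_ge0// ?lerDl// lerBlDr -lerBlDl ltW.
move: sb; rewrite le_eqVlt => /predU1P[<-//|sb].
have [y [sy yb py]] := phid _ as_ sb.
suff : y <= sup A by rewrite leNgt sy.
apply: sup_upper_bound => //; split => //; last exact: le_trans py phis.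
exact: le_trans as_ (ltW sy).
Qed.

(* A Lipschitz function whose derivative is <= M off a null set N grows at rate
   at most M: with U open, N <= U and mu U < e, the function
   g x - (M + e) x - K mu(U /\ ]a, x]) descends to the right of every point,
   the last term absorbing the increments of g at the points of N. *)
Lemma ae_derive_le g a b K M : a <= b -> 0 <= K -> 0 <= M ->
  (forall x y, a <= x -> x <= y -> y <= b -> g y - g x <= K * (y - x)) ->
  (\forall x \ae mu, x \in `[a, b]%R -> derivable g x 1 /\ g^`() x <= M) ->
  g b - g a <= M * (b - a).
Proof.
move=> ab K0 M0 gK [N [mN N0 PN]].
have ba0 : 0 <= b - a by rewrite subr_ge0.
apply/ler_addgt0Pr => e' e'0.
(* The slope [M + e] loses e (b - a), and the measure of U loses at most K e; the 1 keeps the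
   divisor positive. *)
pose e := e' / (b - a + K + 1).
have e0 : 0 < e by rewrite divr_gt0// ltr_wpDl// addr_ge0.
have Noo : (mu N < +oo)%E by rewrite N0.
have [U [oU NU muU]] := lebesgue_regularity_outer mN Noo e0.
have mU : measurable U by exact: open_measurable.
have {}muU : (mu U < e%:E)%E.
  have -> : U = N `|` (U `\` N).
    by rewrite setDUK.
  apply: le_lt_trans muU; rewrite -[leRHS]add0e -N0.
  by apply: measureU2 => //; exact: measurableD.
pose hE x := mu (U `&` `]a, x]).
have mI x : measurable (U `&` `]a, x]) by exact: measurableI.
have hle x : (hE x <= mu U)%E.
  by apply: le_measure; [rewrite inE; exact: mI|rewrite inE|exact: subIsetl].
have hfin x : hE x \is a fin_num.
  by rewrite ge0_fin_numE// (le_lt_trans (hle x))// (lt_trans muU) ?ltry.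
pose h x := fine (hE x).
have hmono x y : x <= y -> h x <= h y.
  move=> xy; apply: fine_le => //; apply: le_measure; try by rewrite inE; exact: mI.
  by apply: setIS => t /=; rewrite !in_itv /= => /andP[-> /le_trans->].
have ha : h a = 0 by rewrite /h /hE set_itvoc0 setI0 measure0.
have hb : h b <= e by rewrite -lee_fin fineK// (le_trans (hle _)) ?ltW.
pose phi x := g x - (M + e) * x - K * h x.
suff : phi b <= phi a.
  rewrite /phi ha mulr0 subr0 => pba.
  have -> : e' = e * (b - a + K + 1).
    by rewrite /e divfK// gt_eqF// ltr_wpDl// addr_ge0.
  have : K * h b <= K * e by rewrite ler_wpM2l.
  nra.
have Me0 : 0 <= M + e by rewrite addr_ge0// ltW.
apply: (@le_of_right_descent _ _ _ K) => // [x y ax xy yb|x ax xb].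
  have := gK _ _ ax xy yb; have := ler_wpM2l K0 (hmono _ _ xy).
  have : 0 <= (M + e) * (y - x) by rewrite mulr_ge0// subr_ge0.
  by rewrite /phi; lra.
have [Nx|Nx] := pselect (N x).
- have /nbhs_ballP[d /= d0 dU] : nbhs x U by apply: open_nbhs_nbhs; split=> //; exact: NU.
  pose y := Num.min b (x + d / 2).
  have xy : x < y by rewrite lt_min xb ltrDl divr_gt0.
  have yb : y <= b by rewrite ge_min lexx.
  exists y; split => //.
  (* Since []x, y]] lies in U, h grows there at rate exactly one. *)
  have hy : h y = h x + (y - x).
    rewrite /h; have -> : hE y = (hE x + (y - x)%:E)%E.
      have -> : (y - x)%:E = mu `]x, y].
        by rewrite lebesgue_measure_itv /= lte_fin xy.
      have dj : (U `&` `]a, x]) `&` `]x, y] = set0.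
        apply/seteqP; split=> t //= [[_ +] +]; rewrite !in_itv /=.
        by move=> /andP[_ tx] /andP[xt _]; move: (lt_le_trans xt tx); rewrite ltxx.
      transitivity (mu ((U `&` `]a, x]) `|` `]x, y])); last first.
        by apply: measureU; [exact: mI|exact: measurable_itv|exact: dj].
      congr (mu _); apply/seteqP; split => t /=; rewrite !in_itv /=.
        move=> [Ut /andP[at_ ty]]; have [tx|xt] := leP t x.
          by left; rewrite at_.
        by right; rewrite ty.
      move=> [[Ut /andP[-> tx]]|/andP[xt ty]]; first by rewrite (le_trans tx) ?ltW.
      split; last by rewrite ty andbT (le_lt_trans ax).
      apply: dU; rewrite /ball /= distrC gtr0_norm ?subr_gt0// ltrBlDl.
      by apply: le_lt_trans ty _; rewrite gt_min ltrD2l ltr_pdivrMr//; apply/orP; right; lra.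
    by rewrite fineD.
  have := gK _ _ ax (ltW xy) yb.
  have : 0 <= (M + e) * (y - x) by rewrite mulr_ge0// subr_ge0 ltW.
  by rewrite /phi hy; lra.
- have [dx gx] : derivable g x 1 /\ g^`() x <= M.
    apply: contrapT => nx; apply: Nx; apply: PN => /= h1.
    by apply/nx/h1; rewrite in_itv /= ax ltW.
  have gM : g^`() x < M + e by rewrite (le_lt_trans gx)// ltrDl.
  have : \forall t \near 0^', t^-1 *: (g (t + x) - g x) < M + e.
    have : (fun t => t^-1 *: (g (t + x) - g x)) @ 0^' --> g^`() x.
      suff : cvg ((fun t => t^-1 *: (g (t + x) - g x)) @ 0^') by [].
      move: dx; rewrite /derivable /=.
      by under eq_fun do rewrite scaler1.
    by move=> /cvgr_lt; apply.
  move=> /nbhs_ballP[d /= d0 dg].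
  pose y := Num.min b (x + d / 2).
  have xy : x < y by rewrite lt_min xb ltrDl divr_gt0.
  have yb : y <= b by rewrite ge_min lexx.
  have yx0 : 0 < y - x by rewrite subr_gt0.
  have yxd : y - x < d.
    by rewrite ltrBlDl gt_min ltrD2l ltr_pdivrMr//; apply/orP; right; lra.
  exists y; split => //.
  have := dg (y - x); rewrite /ball /= sub0r normrN gtr0_norm// => /(_ yxd).
  rewrite gt_eqF// subrK => /(_ isT).
  rewrite /GRing.scale /= mulrC ltr_pdivrMr// => gxy.
  by have := ler_wpM2l K0 (hmono _ _ (ltW xy)); rewrite /phi; lra.
Qed.
End AeDerivative.

(** * Taylor estimates for a Lipschitz derivative *)

Section Smooth.
Context {R : realType}.
Implicit Types (f : R -> R) (D a b x y : R).

(** The form of W^{2,oo} used by all pointwise estimates. Derivatives occur only inside []0, 1[],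
    since at the endpoints [derive1] would see values of f outside the interval. *)
Definition lip_deriv D f := [/\ {in `]0, 1[%R, forall x, derivable f x 1},
  {within `[0, 1], continuous f}, 0 <= D &
  {in `]0, 1[%R &, forall x y, `|derive1 f y - derive1 f x| <= D * `|y - x|}].

Lemma derive1_opp f x : derivable f x 1 -> derive1 (\- f) x = - derive1 f x.
Proof. by move=> fx; rewrite !derive1E deriveN. Qed.

Lemma lip_derivN D f : lip_deriv D f -> lip_deriv D (\- f).
Proof.
move=> [df cf D0 lf]; split => //.
- by move=> x x01; apply: derivableN; exact: df.
- by move=> x; apply: continuousN; exact: cf.
- move=> x y x01 y01; rewrite !derive1_opp; try exact: df.
  by rewrite -opprD normrN; exact: lf.
Qed.

(** The mean value theorem for f minus the quadratic with derivative p + 2 c (x - z); no integral of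
    f' is involved. *)
Lemma quadratic_growth f a b p c z : a <= b ->
  {in `]a, b[%R, forall x, derivable f x 1} -> {within `[a, b], continuous f} ->
  {in `]a, b[%R, forall x, derive1 f x <= p + 2 * c * (x - z)} ->
  f b - f a <= p * (b - a) + c * ((b - z) ^+ 2 - (a - z) ^+ 2).
Proof.
rewrite le_eqVlt => /predU1P[<- _ _ _|ab df cf fle].
  by rewrite !subrr !mulr0 addr0.
pose q (t : R) : R := p * t + c * (t - z) ^+ 2.
have dq (t : R) : is_derive t 1 q (p + 2 * c * (t - z)).
  by apply: is_derive_eq; rewrite /GRing.scale /=; ring.
have [||t tab] := @MVT _ (f - q) (fun t => derive1 f t - (p + 2 * c * (t - z))) a b ab.
- move=> t tab; apply: is_deriveB; rewrite derive1E; apply: derivableP; exact: df.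
- move=> t; apply: cvgB; first exact: cf.
  apply: continuous_subspaceT => u.
  by apply/differentiable_continuous/derivable1_diffP; case: (dq u).
have : (derive1 f t - (p + 2 * c * (t - z))) * (b - a) <= 0.
  by rewrite mulr_le0_ge0 ?subr_le0 ?subr_ge0 ?fle// ltW.
by rewrite /q !fctE /=; lra.
Qed.

Lemma lip_deriv_derivable D f a b : lip_deriv D f -> 0 <= a -> b <= 1 ->
  {in `]a, b[%R, forall x, derivable f x 1}.
Proof.
move=> [df _ _ _] a0 b1 x; rewrite in_itv /= => /andP[ax xb].
by apply: df; rewrite in_itv /= (le_lt_trans a0 ax) (lt_le_trans xb b1).
Qed.

Lemma lip_deriv_continuous D f a b : lip_deriv D f -> 0 <= a -> b <= 1 ->
  {within `[a, b], continuous f}.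
Proof.
move=> [_ cf _ _] a0 b1; apply: continuous_subspaceW cf => x /=.
by rewrite !in_itv /= => /andP[ax xb]; rewrite (le_trans a0 ax) (le_trans xb b1).
Qed.

Lemma taylor_le D f x y : lip_deriv D f -> x \in `]0, 1[%R -> y \in `[0, 1]%R ->
  f y - f x - derive1 f x * (y - x) <= D / 2 * (y - x) ^+ 2.
Proof.
move=> Df x01 y01; have [df _ D0 lf] := Df.
have := x01; have := y01; rewrite !in_itv /= => /andP[y0 y1] /andP[x0 x1].
have [xy|/ltW yx] := leP x y.
  have := @quadratic_growth f x y (derive1 f x) (D / 2) x xy
    (lip_deriv_derivable Df (ltW x0) y1) (lip_deriv_continuous Df (ltW x0) y1).
  rewrite subrr expr0n /= subr0 => H; suff {H}/H : {in `]x, y[%R,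
    forall t, derive1 f t <= derive1 f x + 2 * (D / 2) * (t - x)} by lra.
  move=> t; rewrite in_itv /= => /andP[xt ty].
  have t01 : t \in `]0, 1[%R by rewrite in_itv /= (lt_trans x0) ?(lt_le_trans ty).
  have := lf _ _ x01 t01; rewrite ler_norml [`|t - x|]gtr0_norm ?subr_gt0//.
  by move=> /andP[]; lra.
(* To the left of x, [f y - f x] is the increment of [\- f] over [[y, x]], so the same growth bound
   applies with c = - D / 2. *)
have Dg := lip_derivN Df.
have := @quadratic_growth (\- f) y x (- derive1 f x) (- (D / 2)) x yx
  (lip_deriv_derivable Dg y0 (ltW x1)) (lip_deriv_continuous Dg y0 (ltW x1)).
rewrite subrr expr0n /= sub0r => H; suff {H}/H : {in `]y, x[%R,
  forall t, derive1 (\- f) t <= - derive1 f x + 2 * - (D / 2) * (t - x)} by lra.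
move=> t; rewrite in_itv /= => /andP[yt tx].
have t01 : t \in `]0, 1[%R by rewrite in_itv /= (le_lt_trans y0) ?(lt_trans tx).
rewrite derive1_opp; last exact: df.
have := lf _ _ x01 t01; rewrite distrC ler_norml distrC gtr0_norm ?subr_gt0//.
by move=> /andP[]; lra.
Qed.

Lemma taylor D f x y : lip_deriv D f -> x \in `]0, 1[%R -> y \in `[0, 1]%R ->
  `|f y - f x - derive1 f x * (y - x)| <= D / 2 * (y - x) ^+ 2.
Proof.
move=> Df x01 y01; have [df _ _ _] := Df.
have := taylor_le Df x01 y01.
have := taylor_le (lip_derivN Df) x01 y01.
by rewrite (derive1_opp (df _ x01)) ler_norml /= => h1 h2; apply/andP; split; lra.
Qed.

Lemma chord_slope D f a b x : lip_deriv D f -> x \in `]0, 1[%R ->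
  0 <= a -> b <= 1 -> a <= x -> x <= b ->
  `|derive1 f x * (b - a) - (f b - f a)| <= D / 2 * (b - a) ^+ 2.
Proof.
move=> Df x01 a0 b1 ax xb; have [_ _ D0 _] := Df.
have a01 : a \in `[0, 1]%R by rewrite in_itv /= a0 (le_trans ax) ?(le_trans xb).
have b01 : b \in `[0, 1]%R by rewrite in_itv /= b1 andbT (le_trans a0) ?(le_trans ax).
have := taylor Df x01 a01; have := taylor Df x01 b01.
rewrite !ler_norml => /andP[h1 h2] /andP[h3 h4].
(* The two Taylor remainders add up through (x - a)^2 + (b - x)^2 = (b - a)^2 - 2 (x - a) (b -
   x). *)
have : 0 <= D * ((x - a) * (b - x)) by rewrite !mulr_ge0 ?subr_ge0.
by move=> h; apply/andP; split; lra.
Qed.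

(** Expanding at x with weights b - x and x - a cancels the first-order terms; the remainders sum to
    at most D / 2 (x - a) (b - x) (b - a). *)
Lemma interpolation_error D f a b x : lip_deriv D f -> x \in `]0, 1[%R ->
  0 <= a -> b <= 1 -> a <= x -> x <= b ->
  `|f x * (b - a) - (f a * (b - x) + f b * (x - a))| <= D / 8 * (b - a) ^+ 3.
Proof.
move=> Df x01 a0 b1 ax xb; have [_ _ D0 _] := Df.
have a01 : a \in `[0, 1]%R by rewrite in_itv /= a0 (le_trans ax) ?(le_trans xb).
have b01 : b \in `[0, 1]%R by rewrite in_itv /= b1 andbT (le_trans a0) ?(le_trans ax).
have := taylor Df x01 a01; have := taylor Df x01 b01.
set ra := f a - _ - _; set rb := f b - _ - _ => hb ha.
have -> : f x * (b - a) - (f a * (b - x) + f b * (x - a)) =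
    - (ra * (b - x) + rb * (x - a)) by rewrite /ra /rb; ring.
rewrite normrN (le_trans (ler_normD _ _))// !normrM.
rewrite [`|b - x|]ger0_norm ?subr_ge0// [`|x - a|]ger0_norm ?subr_ge0//.
apply: (@le_trans _ _ (D / 2 * (a - x) ^+ 2 * (b - x) + D / 2 * (b - x) ^+ 2 * (x - a))).
  by apply: lerD; apply: ler_wpM2r; rewrite ?subr_ge0.
(* This is the gap in 4 (x - a) (b - x) <= (b - a)^2, which produces the constant 8. *)
have : 0 <= D / 8 * ((b - a) * (b + a - 2 * x) ^+ 2).
  apply: mulr_ge0; first exact: divr_ge0.
  by apply: mulr_ge0 (sqr_ge0 _); rewrite subr_ge0 (le_trans ax).
lra.
Qed.

(** At the midpoint b the first-order terms cancel, leaving two remainders of D / 2 (b - a)^2. *)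
Lemma second_difference D f a b c : lip_deriv D f -> b \in `]0, 1[%R ->
  0 <= a -> c <= 1 -> a <= b -> c - b = b - a ->
  `|f a - 2 * f b + f c| <= D * (b - a) ^+ 2.
Proof.
move=> Df b01 a0 c1 ab cba; have [_ _ D0 _] := Df.
have /andP[b0 b1] : 0 < b < 1 by move: b01; rewrite in_itv.
have a01 : a \in `[0, 1]%R by rewrite in_itv /= a0 (le_trans ab) ?ltW.
have c01 : c \in `[0, 1]%R by rewrite in_itv /= c1 andbT; lra.
have := taylor Df b01 a01; have := taylor Df b01 c01.
rewrite cba -(opprB b a) sqrrN !ler_norml => /andP[h1 h2] /andP[h3 h4].
by apply/andP; split; lra.
Qed.

Lemma mean_value D f a b : lip_deriv D f -> 0 <= a -> b <= 1 -> a < b ->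
  exists2 x, x \in `]0, 1[%R & f b - f a = derive1 f x * (b - a).
Proof.
move=> Df a0 b1 ab; have df := lip_deriv_derivable Df a0 b1.
have [||x xab ->] := @MVT _ f (derive1 f) a b ab.
- by move=> t tab; rewrite derive1E; apply: derivableP; exact: df.
- exact: lip_deriv_continuous Df a0 b1.
exists x => //; move: xab; rewrite !in_itv /= => /andP[ax xb].
by rewrite (le_lt_trans a0 ax) (lt_le_trans xb b1).
Qed.

End Smooth.

(** * Pointwise bounds from the essential norms on W^{2,oo} *)

Section W2infty.
Context {R : realType}.
Implicit Types (f : R -> R).
Local Notation mu := (@lebesgue_measure R).
Local Notation D f := (fine (norm_d2 f)).
Local Notation S f := (fine (norm_slope f)).

(** Membership only provides some Lipschitz constant K for f'; [ae_derive_le], applied to f' and to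
    its opposite, sharpens it to the essential bound on f''. *)
Lemma W2infty_lip_deriv f : W2infty f -> lip_deriv (D f) f.
Proof.
move=> [fd [K0 [_ fK]] fae foo].
have D0 : 0 <= D f by rewrite fine_ge0 ?Linfty_ge0.
split => //; [by case: fd|exact: derivable_oo_LRcontinuous_within|].
(* The Lipschitz clause holds for every constant above [K0]; this choice is also nonnegative. *)
pose K := Num.max K0 0 + 1.
have K_ge0 : 0 <= K by rewrite addr_ge0// le_max lexx orbT.
have lK x y : x \in `]0, 1[%R -> y \in `]0, 1[%R ->
    `|derive1 f x - derive1 f y| <= K * `|x - y|.
  move=> x01 y01; have K0K : K0 < K.
    by rewrite (@le_lt_trans _ _ (Num.max K0 0)) ?le_max ?lexx ?ltrDl.
  exact: (fK K K0K (x, y)).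
have aeD : \forall x \ae mu, x \in `]0, 1[%R ->
    derivable (derive1 f) x 1 /\ `|derive1n 2 f x| <= D f.
  have dae := Linfty_ae foo.
  apply: (@filterS2 _ _ (ae_filter_ringOfSetsType mu) _ _ _ _ fae dae) => x h1 h2 x01.
  by split; [exact: h1|exact: h2].
have main x y : x \in `]0, 1[%R -> y \in `]0, 1[%R -> x <= y ->
    `|derive1 f y - derive1 f x| <= D f * (y - x).
  move=> x01 y01 xy.
  have sub t : x <= t -> t <= y -> t \in `]0, 1[%R.
    move: x01 y01; rewrite !in_itv /= => /andP[x0 _] /andP[_ y1] xt ty.
    by rewrite (lt_le_trans x0 xt) (le_lt_trans ty y1).
  rewrite ler_norml; apply/andP; split; last first.
    apply: (@ae_derive_le _ (derive1 f) _ _ K) => //.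
      move=> u v xu uv vy; rewrite -[v - u]ger0_norm ?subr_ge0//.
      apply: le_trans (ler_norm _) (lK _ _ _ _); apply: sub => //.
        exact: le_trans uv.
      exact: le_trans vy.
    apply: (@filterS _ _ (ae_filter_ringOfSetsType mu) _ _ _ aeD) => t tD.
  rewrite in_itv /= => /andP[xt ty].
    have [? /ler_normlP[_ ?]] := tD (sub _ xt ty); by split.
  rewrite lerNl opprB.
  have -> : derive1 f x - derive1 f y = (\- derive1 f) y - (\- derive1 f) x.
    by rewrite /= opprK addrC.
  apply: (@ae_derive_le _ (\- derive1 f) _ _ K) => //.
    move=> u v xu uv vy; rewrite -[v - u]ger0_norm ?subr_ge0//=.
    apply: le_trans (ler_norm _) _.
    rewrite -opprD normrN; apply: lK; apply: sub => //.
      exact: le_trans uv.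
    exact: le_trans vy.
  apply: (@filterS _ _ (ae_filter_ringOfSetsType mu) _ _ _ aeD) => t tD.
  rewrite in_itv /= => /andP[xt ty].
  have [dt /ler_normlP[? _]] := tD (sub _ xt ty); split.
    exact: derivableN.
  by rewrite derive1_opp.
move=> x y x01 y01; have [xy|/ltW yx] := leP x y.
  by rewrite [`|y - x|]ger0_norm ?subr_ge0 ?main.
by rewrite distrC [`|y - x|]distrC [`|x - y|]ger0_norm ?subr_ge0 ?main.
Qed.

Lemma norm_d2E f : W2infty f -> norm_d2 f = (D f)%:E.
Proof. by move=> [_ _ _ foo]; rewrite fineK// ge0_fin_numE// Linfty_ge0. Qed.

Lemma norm_slope_le_d2 f : W2infty f -> (norm_slope f <= (D f / 2)%:E)%E.
Proof.
move=> /W2infty_lip_deriv Df; have [_ _ D0 _] := Df.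
apply: Linfty_le => [|x x01]; first by rewrite divr_ge0.
have := @chord_slope _ _ _ 0 1 x Df x01 (lexx _) (lexx _).
rewrite subr0 expr1n !mulr1 opprD opprK addrA; apply.
  by move: x01; rewrite in_itv => /andP[/ltW].
by move: x01; rewrite in_itv => /andP[_ /ltW].
Qed.

Lemma norm_slopeE f : W2infty f -> norm_slope f = (S f)%:E.
Proof.
move=> Wf; rewrite fineK// ge0_fin_numE ?Linfty_ge0//.
by rewrite (le_lt_trans (norm_slope_le_d2 Wf)) ?ltry.
Qed.

(** The essential bound extends to every x because f' is continuous: it holds at some y within e /
    (D + 1) to the right of x. Points given by the mean value theorem can then be used. *)
Lemma le_norm_slope f x : W2infty f -> x \in `]0, 1[%R ->
  `|derive1 f x - f 1 + f 0| <= S f.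
Proof.
move=> Wf x01; have [_ _ D0 lf] := W2infty_lip_deriv Wf.
have soo : (norm_slope f < +oo)%E by rewrite norm_slopeE ?ltry.
have aeS := Linfty_ae soo.
apply/ler_addgt0Pr => e e0.
pose d := e / (D f + 1).
have d0 : 0 < d by rewrite divr_gt0// ltr_wpDl.
have /andP[x0 x1] : 0 < x < 1 by move: x01; rewrite in_itv.
have xy : x < Num.min 1 (x + d) by rewrite lt_min x1 ltrDl.
have [y + yS] := ae_itvoo xy aeS.
rewrite in_itv /= lt_min => /and3P[xly y1 yd].
have y01 : y \in `]0, 1[%R by rewrite in_itv /= (lt_trans x0 xly).
have -> : derive1 f x - f 1 + f 0 = (derive1 f y - f 1 + f 0) - (derive1 f y - derive1 f x) by ring.
rewrite (le_trans (ler_normB _ _))// lerD ?yS//.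
rewrite (le_trans (lf _ _ x01 y01))// gtr0_norm ?subr_gt0//.
have -> : e = (D f + 1) * d by rewrite /d mulrC divfK// gt_eqF// ltr_wpDl.
apply: ler_pM => //; first by rewrite subr_ge0 ltW.
  by rewrite lerDl.
by rewrite lerBlDl ltW.
Qed.

End W2infty.

(** * The linear spline and its data-based quantities *)

Section SplineEstimates.
Context {R : realType}.
Implicit Types (f : R -> R) (D x : R) (m i : nat).

(** From here on m counts mesh cells: n is [m.+1] and n - 1 becomes m. *)
Lemma nodeE m i : node m.+1 i = i%:R / m%:R :> R.
Proof. by rewrite /node -[m.+1%:R]natr1 addrK. Qed.

Lemma node_ge0 m i : 0 <= node m.+1 i :> R.
Proof. by rewrite nodeE divr_ge0. Qed.

Lemma node_le1 m i : (0 < m)%N -> (i <= m)%N -> node m.+1 i <= 1 :> R.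
Proof. by move=> m0 im; rewrite nodeE ler_pdivrMr ?ltr0n// mul1r ler_nat. Qed.

Lemma nodeS m i : node m.+1 i.+1 - node m.+1 i = m%:R^-1 :> R.
Proof. by rewrite !nodeE -mulrBl -natr1 addrAC subrr add0r mul1r. Qed.

Lemma ltr_nodeS m i : (0 < m)%N -> node m.+1 i < node m.+1 i.+1 :> R.
Proof. by move=> m0; rewrite -subr_gt0 nodeS invr_gt0 ltr0n. Qed.

Definition cell m x := minn (Num.truncn (x * m%:R)) m.-1.

Lemma cell_lt m x : (0 < m)%N -> (cell m x < m)%N.
Proof. by case: m => // m _; rewrite /cell ltnS geq_minr. Qed.

Lemma node_cell m x : (0 < m)%N -> x \in `[0, 1]%R ->
  node m.+1 (cell m x) <= x <= node m.+1 (cell m x).+1.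
Proof.
move=> m0; rewrite in_itv /= => /andP[x0 x1]; rewrite !nodeE.
have m0' : 0 < m%:R :> R by rewrite ltr0n.
rewrite ler_pdivrMr// ler_pdivlMr// /cell.
have /andP[tx xt] := truncn_itv (mulr_ge0 x0 (ltW m0')).
apply/andP; split; first by rewrite (le_trans _ tx)// ler_nat geq_minl.
(* Either the cap is inactive and truncation gives the bound, or the right node of the cell is 1. *)
have [?|?] := leqP (Num.truncn (x * m%:R)) m.-1; first exact: ltW.
by rewrite prednK// -[leRHS]mul1r ler_wpM2r// ltW.
Qed.

Lemma splineE m f x : spline m.+1 f x = m%:R *
  (f (node m.+1 (cell m x)) * (node m.+1 (cell m x).+1 - x) +
   f (node m.+1 (cell m x).+1) * (x - node m.+1 (cell m x))).
Proof. by rewrite /spline -[m.+1%:R]natr1 addrK subSS subn1. Qed.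

Lemma spline_error D f m x : (0 < m)%N -> lip_deriv D f -> x \in `]0, 1[%R ->
  `|f x - spline m.+1 f x| <= D / (8 * m%:R ^+ 2).
Proof.
move=> m0 Df x01; have m0' : 0 < m%:R :> R by rewrite ltr0n.
have /andP[ax xb] := node_cell m0 (subset_itv_oo_cc x01).
have := interpolation_error Df x01 (node_ge0 _ _)
  (node_le1 m0 (cell_lt x m0)) ax xb.
rewrite nodeS splineE; set u := f _ * _ + f _ * _ => h.
have -> : f x - m%:R * u = m%:R * (f x * m%:R^-1 - u).
  by rewrite mulrBr mulrCA divff ?mulr1// gt_eqF.
rewrite normrM gtr0_norm// (le_trans (ler_wpM2l (ltW m0') h))//.
by rewrite le_eqVlt; apply/orP; left; apply/eqP; field; rewrite gt_eqF.
Qed.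

Lemma FtildeE m f : Ftilde m.+1 f = \big[Num.max/0]_(0 <= i < m)
  `|m%:R * (f (node m.+1 i.+1) - f (node m.+1 i)) - f 1 + f 0|.
Proof. by rewrite /Ftilde -[m.+1%:R]natr1 addrK subn1. Qed.

Lemma FhatE m f : Fhat m.+1 f = m%:R ^+ 2 * \big[Num.max/0]_(0 <= i < m.-1)
  `|f (node m.+1 i) - 2 * f (node m.+1 i.+1) + f (node m.+1 i.+2)|.
Proof. by rewrite /Fhat -[m.+1%:R]natr1 addrK subSS subn1. Qed.

Lemma Ftilde_ge0 m f : 0 <= Ftilde m.+1 f.
Proof.
rewrite FtildeE; elim/big_rec: _ => // i y _ y0.
by rewrite le_max y0 orbT.
Qed.

Lemma Fhat_ge0 m f : 0 <= Fhat m.+1 f.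
Proof.
rewrite FhatE mulr_ge0 ?sqr_ge0//; elim/big_rec: _ => // i y _ y0.
by rewrite le_max y0 orbT.
Qed.

(** By the mean value theorem each secant slope is a value of f'. *)
Lemma Ftilde_le m f : (0 < m)%N -> W2infty f ->
  Ftilde m.+1 f <= fine (norm_slope f).
Proof.
move=> m0 Wf; rewrite FtildeE big_nat; apply: bigmax_le => [|i /andP[_ im]].
  by rewrite fine_ge0 ?Linfty_ge0.
have [x x01 ->] := mean_value (W2infty_lip_deriv Wf) (node_ge0 m i)
  (node_le1 m0 im) (ltr_nodeS i m0).
rewrite nodeS mulrCA divff ?mulr1 ?pnatr_eq0 ?gtn_eqF//.
exact: le_norm_slope.
Qed.

(** Compare f' at x with the secant slope of the cell containing x. *)
Lemma norm_slope_le m f : (0 < m)%N -> W2infty f ->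
  fine (norm_slope f) <= Ftilde m.+1 f + fine (norm_d2 f) / (2 * m%:R).
Proof.
move=> m0 Wf; have Df := W2infty_lip_deriv Wf; have [_ _ D0 _] := Df.
have m0' : 0 < m%:R :> R by rewrite ltr0n.
rewrite -lee_fin -norm_slopeE//; apply: Linfty_le => [|x x01].
  by rewrite addr_ge0 ?Ftilde_ge0// divr_ge0// mulr_ge0.
have /andP[ax xb] := node_cell m0 (subset_itv_oo_cc x01).
have := chord_slope Df x01 (node_ge0 _ _) (node_le1 m0 (cell_lt x m0)) ax xb.
rewrite nodeS; set b := node _ _.+1; set a := node _ _ => h.
have -> : derive1 f x - f 1 + f 0 = (m%:R * (f b - f a) - f 1 + f 0) +
    m%:R * (derive1 f x * m%:R^-1 - (f b - f a)).
  by field; rewrite gt_eqF.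
rewrite (le_trans (ler_normD _ _))// lerD//.
  rewrite FtildeE; apply: (bigmax_sup_seq _ (cell m x)) => //.
  by rewrite mem_index_iota cell_lt.
rewrite normrM gtr0_norm// (le_trans (ler_wpM2l (ltW m0') h))//.
by rewrite le_eqVlt; apply/orP; left; apply/eqP; field; rewrite gt_eqF.
Qed.

Lemma Fhat_le m f : (0 < m)%N -> W2infty f -> Fhat m.+1 f <= fine (norm_d2 f).
Proof.
move=> m0 Wf; have Df := W2infty_lip_deriv Wf; have [_ _ D0 _] := Df.
have m0' : 0 < m%:R :> R by rewrite ltr0n.
rewrite FhatE -ler_pdivlMl ?exprn_gt0// big_nat; apply: bigmax_le => [|i /andP[_ im]].
  by rewrite mulr_ge0// invr_ge0 exprn_ge0// ltW.
have iSm : (i.+1 < m)%N by rewrite -ltn_predRL.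
have i01 : (node m.+1 i.+1 : R) \in `]0, 1[%R.
  rewrite in_itv /= (le_lt_trans (node_ge0 m i)) ?ltr_nodeS//=.
  by rewrite (lt_le_trans (ltr_nodeS _ m0)) ?node_le1.
have := second_difference Df i01 (node_ge0 m i) (node_le1 m0 iSm)
  (ltW (ltr_nodeS _ m0)).
by rewrite !nodeS => /(_ erefl); rewrite exprVn [leRHS]mulrC.
Qed.

End SplineEstimates.

(** * Costs and runs of the algorithms *)

Section Cost.
Context {R : realType}.
Implicit Types (x eps sigma : R) (m k : nat).

Lemma ceiln_le x m : 0 <= x -> (ceiln x <= m)%N = (x <= m%:R).
Proof.
move=> x0; rewrite -lez_nat /ceiln gez0_abs ?ceil_le_int//.
by rewrite ceil_ge0 (lt_le_trans _ x0)// ltrN10.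
Qed.

Lemma ceilnE x : 0 <= x -> (ceiln x)%:Z = Num.ceil x.
Proof.
by move=> x0; rewrite /ceiln gez0_abs// ceil_ge0 (lt_le_trans _ x0)// ltrN10.
Qed.

Lemma ceiln_ge x : 0 <= x -> x <= (ceiln x)%:R.
Proof. by move=> x0; rewrite -ceiln_le. Qed.

Lemma ceiln_lt x : 0 <= x -> (ceiln x)%:R < x + 1.
Proof.
move=> x0; have := ceilB1_lt x.
by rewrite -ceilnE// rmorphB /= ltrBlDr.
Qed.

Lemma sqrtr_le_pos x y : 0 < y -> (Num.sqrt x <= y) = (x <= y ^+ 2).
Proof. by move=> y0; rewrite -[RHS]ler_sqrt ?sqr_ge0// sqrtr_sqr gtr0_norm. Qed.

Lemma uniq_nodes m : (0 < m)%N -> uniq (nodes m.+1 : seq R).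
Proof.
move=> m0; rewrite map_inj_uniq ?iota_uniq// => i j.
rewrite !nodeE => /(divIf _); rewrite pnatr_eq0 -lt0n => /(_ m0) /eqP.
by rewrite eqr_nat => /eqP.
Qed.

(** Nesting is what makes the cost of a run equal to the size of its last mesh. *)
Lemma sub_nodes m k : (0 < m)%N -> (0 < k)%N ->
  {subset (nodes m.+1 : seq R) <= nodes (m * k).+1}.
Proof.
move=> m0 k0 _ /mapP[i + ->]; rewrite mem_iota /= add0n ltnS => im.
apply/mapP; exists (i * k)%N; first by rewrite mem_iota /= add0n ltnS leq_mul.
rewrite !nodeE !natrM -mulf_div divff ?mulr1//.
by rewrite pnatr_eq0 -lt0n.
Qed.

Lemma ncost_nodes (r : @result R) m : (0 < m)%N ->
  samples r =i nodes m.+1 -> ncost r = m.+1.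
Proof.
move=> m0 /perm_undup/perm_size; rewrite /ncost => ->.
by rewrite undup_id ?uniq_nodes// size_map size_iota.
Qed.

Lemma hn_le sigma eps m : 0 < sigma -> 0 < eps -> (0 < m)%N ->
  (hn m.+1 <= eps / sigma) = (Num.sqrt (sigma / (8 * eps)) <= m%:R).
Proof.
move=> s0 e0 m0; have m0' : 0 < m%:R :> R by rewrite ltr0n.
rewrite /hn -[m.+1%:R]natr1 addrK.
rewrite sqrtr_le_pos// -[_^-1]mul1r ler_pdivrMr ?mulr_gt0 ?exprn_gt0// ler_pdivrMr ?mulr_gt0//.
rewrite mulrAC ler_pdivlMr// mul1r.
by congr (_ <= _); ring.
Qed.

Lemma nonadaptive_nE sigma eps : 0 < sigma -> 0 < eps ->
  nonadaptive_n sigma eps = (ceiln (Num.sqrt (sigma / (8 * eps)))).+1.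
Proof.
move=> s0 e0; set q := Num.sqrt _.
have q0 : 0 < q by rewrite sqrtr_gt0 divr_gt0 ?mulr_gt0.
(* The ceiling is at least 1, so the constraint n >= 2 does not alter the minimum. *)
have c0 : (0 < ceiln q)%N by rewrite ltnNge ceiln_le ?(ltW q0)// -ltNge.
have hk k : (2 <= k)%N -> (hn k <= eps / sigma) = (ceiln q < k)%N.
  by case: k => [//|m] m0; rewrite hn_le// ltnS ceiln_le ?(ltW q0).
rewrite /nonadaptive_n; case: xgetP => [n _ [n2 hn1 nmin]|/(_ (ceiln q).+1)[]].
  apply/eqP; rewrite eqn_leq -hk// hn1 andbT.
  by apply: nmin; rewrite ?hk.
by split => [//||k k2]; rewrite hk.
Qed.

End Cost.

(** * The adaptive algorithm on the cone: stopping test, mesh growth and termination *)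

Section Adaptive.
Context {R : realType}.
Variables (tau eps : R) (f : R -> R).
Hypotheses (tau2 : 2 <= tau) (eps0 : 0 < eps) (f_cone : cone tau f).
Local Notation D := (fine (norm_d2 f)).
Local Notation S := (fine (norm_slope f)).
Local Notation Q := (Num.sqrt (tau * S / (8 * eps))).

Let tau0 : 0 < tau. Proof. exact: lt_le_trans tau2. Qed.
Let Wf : W2infty f. Proof. by case: f_cone. Qed.
Let S0 : 0 <= S. Proof. by rewrite fine_ge0 ?Linfty_ge0. Qed.
Let D0 : 0 <= D. Proof. by rewrite fine_ge0 ?Linfty_ge0. Qed.

Lemma cone_le : D <= tau * S.
Proof.
by have [_] := f_cone; rewrite norm_d2E// norm_slopeE// -EFinM lee_fin.
Qed.

Lemma cone_slope_le m : tau < 2 * m%:R ->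
  (2 * m%:R - tau) * S <= 2 * m%:R * Ftilde m.+1 f.
Proof.
move=> taum; have m0 : 0 < m%:R :> R by have := tau0; lra.
have := norm_slope_le (_ : (0 < m)%N) Wf; rewrite -(ltr0n R) => /(_ m0) h.
have : 2 * m%:R * S <= 2 * m%:R * (Ftilde m.+1 f + D / (2 * m%:R)).
  by rewrite ler_wpM2l// mulr_ge0// ltW.
rewrite mulrDr [_ * (D / _)]mulrC divfK; last by rewrite mulf_neq0 ?gt_eqF.
by have := cone_le; lra.
Qed.

Lemma tau_min_le m : tau < 2 * m%:R -> tau_min m.+1 f <= tau.
Proof.
move=> taum; have m0 : 0 < m%:R :> R by have := tau0; lra.
have m0' : (0 < m)%N by rewrite -(ltr0n R).
have := norm_slope_le m0' Wf; have := cone_le; have := Fhat_le m0' Wf.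
have := @Fhat_ge0 _ m f; have := @Ftilde_ge0 _ m f.
rewrite /tau_min -[m.+1%:R]natr1.
have -> : 2 * (m%:R + 1) - 2 = 2 * m%:R :> R by ring.
set F := Fhat _ _; set Ft := Ftilde _ _ => Ft0 F0 FD DS SF.
have m2 : 0 < 2 * m%:R :> R by rewrite mulr_gt0.
have : 0 <= Ft + F / (2 * m%:R) by rewrite addr_ge0// divr_ge0// ltW.
(* A zero denominator makes [tau_min] equal to 0. *)
rewrite le_eqVlt => /predU1P[<-|den0]; first by rewrite invr0 mulr0 ltW.
rewrite ler_pdivrMr//.
set u := (2 * m%:R)^-1 in SF *.
have u1 : 0 <= 1 - tau * u by rewrite subr_ge0 ler_pdivrMr ?mul1r ?ltW.
(* The goal reads F (1 - tau u) <= tau Ft, and the cone condition gives D (1 - tau u) <= tau Ft. *)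
have : F * (1 - tau * u) <= D * (1 - tau * u) by rewrite ler_wpM2r.
have : tau * S <= tau * (Ft + D * u) by rewrite ler_wpM2l// ltW.
lra.
Qed.

Lemma stage2E m : tau < 2 * m%:R -> stage2 eps f tau m.+1 =
  if Ftilde m.+1 f <= 4 * eps * m%:R * (2 * m%:R - tau) / tau then Return
  else Next tau (m * maxn 2 (ceiln
    (m%:R^-1 * Num.sqrt (tau * Ftilde m.+1 f / (8 * eps))))).+1.
Proof.
move=> taum; rewrite /stage2 tau_min_le// /stage3.
rewrite -[m.+1%:R]natr1 addrK subn1 add1n.
by have -> : 2 * (m%:R + 1) - 2 = 2 * m%:R :> R by ring.
Qed.

(** The test and [cone_slope_le] bound tau S (2m - tau) by 8 eps m^2 (2m - tau); the common factor
    is positive. *)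
Lemma return_slope_le m : tau < 2 * m%:R ->
  Ftilde m.+1 f <= 4 * eps * m%:R * (2 * m%:R - tau) / tau -> Q <= m%:R.
Proof.
move=> taum; have m0 : 0 < m%:R :> R by have := tau0; lra.
rewrite ler_pdivlMr// => hF; have := cone_slope_le taum => hS.
rewrite sqrtr_le_pos// ler_pdivrMr ?mulr_gt0//.
have d0 : 0 < 2 * m%:R - tau by rewrite subr_gt0.
rewrite -(ler_pM2l d0).
have : tau * ((2 * m%:R - tau) * S) <= tau * (2 * m%:R * Ftilde m.+1 f).
  by rewrite ler_wpM2l// ltW.
have : 2 * m%:R * (Ftilde m.+1 f * tau) <=
   2 * m%:R * (4 * eps * m%:R * (2 * m%:R - tau)).
  by rewrite ler_wpM2l// mulr_ge0// ltW.
lra.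
Qed.

Lemma Ftilde_sqrt_le m : (0 < m)%N ->
  Num.sqrt (tau * Ftilde m.+1 f / (8 * eps)) <= Q.
Proof.
move=> m0; apply: ler_wsqrtr; apply: ler_wpM2r.
  by rewrite invr_ge0 mulr_ge0// ltW.
by rewrite ler_pM2l// Ftilde_le.
Qed.

Lemma continue_lt m : tau < 2 * m%:R ->
  4 * eps * m%:R * (2 * m%:R - tau) / tau < Ftilde m.+1 f ->
  m%:R < tau / 2 + Q.
Proof.
move=> taum; have m0 : 0 < m%:R :> R by have := tau0; lra.
have m0' : (0 < m)%N by rewrite -(ltr0n R).
rewrite ltr_pdivrMr// => hF; rewrite ltNge; apply/negP => hm.
have Q0 : 0 <= Q by exact: sqrtr_ge0.
have : Q ^+ 2 = tau * S / (8 * eps).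
  by rewrite sqr_sqrtr// divr_ge0 ?mulr_ge0// ltW.
move/(congr1 ( *%R^~ (8 * eps))); rewrite divfK ?mulf_neq0 ?gt_eqF// => QE.
have hS : Ftilde m.+1 f * tau <= S * tau by rewrite ler_wpM2r ?Ftilde_le// ltW.
(* If m >= tau / 2 + Q, both factors are at least Q; then tau S <= 4 eps m (2m - tau), contradicting
   the failed test since Ftilde <= S. *)
have : Q ^+ 2 <= m%:R * (m%:R - tau / 2).
  rewrite expr2; apply: ler_pM => //; last by lra.
  by have := tau0; lra.
by move=> /(ler_wpM2r (ltW eps0)); lra.
Qed.

Lemma next_le m : tau < 2 * m%:R ->
  4 * eps * m%:R * (2 * m%:R - tau) / tau < Ftilde m.+1 f ->
  (m * maxn 2 (ceiln
    (m%:R^-1 * Num.sqrt (tau * Ftilde m.+1 f / (8 * eps)))))%:R <= 2 * Q + tau.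
Proof.
move=> taum hF; have m0 : 0 < m%:R :> R by have := tau0; lra.
have m0' : (0 < m)%N by rewrite -(ltr0n R).
have hm := continue_lt taum hF; have hq := Ftilde_sqrt_le m0'.
set q := Num.sqrt (tau * Ftilde _ _ / _) in hq *.
have q0 : 0 <= m%:R^-1 * q by rewrite mulr_ge0 ?sqrtr_ge0// invr_ge0 ltW.
have [c2|c2] := leqP (ceiln (m%:R^-1 * q)) 2; first by rewrite natrM; lra.
(* A factor above 2 forces m < q / 2, so rounding up costs less than q / 2 cells and the next mesh
   has fewer than 3 q / 2. *)
have mq : 2 * m%:R < q.
  by rewrite -ltr_pdivlMr// mulrC ltNge -ceiln_le// -ltnNge.
have := ceiln_lt q0; rewrite -(ltr_pM2l m0) mulrDr mulr1 mulrA divff ?gt_eqF//.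
by rewrite mul1r natrM; have := tau0; lra.
Qed.

(** Only refined meshes obey the bound 2 Q + tau, hence the case [M = m] for a run that returns at
    once. Divisibility gives nested nodes, so the samples reduce to the final mesh. *)
Lemma adaptive_iter_sound k m r : tau < 2 * m%:R ->
  adaptive_iter k eps f tau m.+1 = Some r ->
  exists M, [/\ (m %| M)%N, (0 < M)%N, Q <= M%:R,
    M = m \/ M%:R <= 2 * Q + tau &
    output r = spline M.+1 f /\ samples r =i nodes M.+1].
Proof.
elim: k m r => // k IH m r taum /=; rewrite stage2E//.
have m0 : 0 < m%:R :> R by have := tau0; lra.
have m0' : (0 < m)%N by rewrite -(ltr0n R).
case: (leP (Ftilde m.+1 f)) => [hF [<-]|hF].
  by exists m; split=> //; [exact: return_slope_le|left].
have := next_le taum hF; set c := maxn _ _ => hc.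
have c2 : (2 <= c)%N by rewrite leq_max.
have tauc : tau < 2 * (m * c)%:R.
  apply: lt_le_trans taum _; rewrite ler_wpM2l// ler_nat leq_pmulr//.
  exact: leq_trans c2.
case E: adaptive_iter => [r'|//] [<-].
have [M [mM M0 QM MQ [out sam]]] := IH _ _ tauc E.
have mdM : (m %| M)%N by apply: dvdn_trans mM; exact: dvdn_mulr.
exists M; split => //; first by case: MQ => [->|]; right.
split=> // x.
rewrite [LHS](_ : _ = (x \in nodes m.+1 ++ samples r'))// mem_cat sam.
case: (boolP (x \in nodes m.+1)) => // xm.
have /dvdnP[k' Mk'] := mdM; rewrite Mk' mulnC sub_nodes//.
by move: M0; rewrite Mk' muln_gt0 => /andP[].
Qed.

(** By [continue_lt] a mesh with at least tau / 2 + Q cells returns, and each refinement adds at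
    least one cell, so [B <= m + k] is preserved. *)
Lemma adaptive_iter_total k m B : tau < 2 * m%:R -> tau / 2 + Q <= B%:R ->
  (B <= m + k)%N -> adaptive_iter k.+1 eps f tau m.+1.
Proof.
move=> + hB; elim: k m => [|k IH] m taum mk /=; rewrite stage2E//.
  case: leP => // hF; have := continue_lt taum hF.
  move: mk; rewrite addn0 -(ler_nat R) => Bm; lra.
case: leP => // hF.
have m0' : (0 < m)%N by rewrite -(ltr0n R); have := tau0; lra.
set c := maxn _ _.
have c2 : (2 <= c)%N by rewrite leq_max.
have mc : (m.+1 <= m * c)%N.
  by rewrite (@leq_trans (m * 2))// ?leq_mul2l ?c2 ?orbT// muln2 -addnn -addn1 leq_add2l.
have tauc : tau < 2 * (m * c)%:R.
  apply: lt_le_trans taum _; rewrite ler_wpM2l// ler_nat.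
  exact: leq_trans mc.
have : adaptive_iter k.+1 eps f tau (m * c).+1.
  by apply: IH tauc _; rewrite (leq_trans mk)// addnS -addSn leq_add2r.
by move=> /=; case: (match _ with Next _ _ => _ | Return => _ end).
Qed.

Lemma adaptive_bounds : exists r M, [/\ adaptive tau eps f = Some r,
  output r = spline M.+1 f, (0 < M)%N /\ ncost r = M.+1,
  (tau + 1) / 2 <= M%:R /\ Q <= M%:R & M%:R <= 2 * Q + tau + 3].
Proof.
have tau10 : 0 <= (tau + 1) / 2 by have := tau0; lra.
rewrite /adaptive addn1; set m := ceiln _.
have mtau : (tau + 1) / 2 <= m%:R by exact: ceiln_ge.
have taum : tau < 2 * m%:R by lra.
set k0 := xget _ _.
pose run k := adaptive_iter k eps f tau m.+1.
have : exists k, run k.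
  have Q0 : 0 <= tau / 2 + Q by rewrite addr_ge0 ?sqrtr_ge0// divr_ge0 ?ltW.
  exists (ceiln (tau / 2 + Q)).+1; apply: (adaptive_iter_total taum (ceiln_ge Q0)).
  exact: leq_addl.
(* The number of passes picked by [xget] is some successful one, and soundness holds for any. *)
move=> /(@xgetPex _ 0%N [set k | run k]) /=; rewrite -/k0 /run.
case E: (adaptive_iter k0 _ _ _ _) => [r|//] _.
have [M [mM M0 QM MQ [out sam]]] := adaptive_iter_sound taum E.
have mleM : m%:R <= M%:R :> R by rewrite ler_nat dvdn_leq.
exists r, M; split => //.
- by split=> //; exact: ncost_nodes.
- by split=> //; exact: le_trans mleM.
- have Q0 : 0 <= Q by exact: sqrtr_ge0.
  (* If the initial mesh is final, M < (tau + 1) / 2 + 1, which is below tau + 3. *)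
  case: MQ => [->|]; last by lra.
  by have := ceiln_lt tau10; have := tau2; rewrite -/m; lra.
Qed.

End Adaptive.

(** Shared by both algorithms, with c = sigma on the ball and c = tau S on the cone. *)
Lemma spline_Linfty (R : realType) (f : R -> R) (c eps : R) m :
  W2infty f -> 0 < eps -> (0 < m)%N -> fine (norm_d2 f) <= c ->
  Num.sqrt (c / (8 * eps)) <= m%:R ->
  (Linfty (fun x => f x - spline m.+1 f x)%R <= eps%:E)%E.
Proof.
move=> Wf eps0 m0 Dc; have m0' : 0 < m%:R :> R by rewrite ltr0n.
rewrite sqrtr_le_pos// ler_pdivrMr ?mulr_gt0// => hc.
apply: Linfty_le => [|x x01]; first exact: ltW.
apply: le_trans (spline_error m0 (W2infty_lip_deriv Wf) x01) _.
by rewrite ler_pdivrMr ?mulr_gt0 ?exprn_gt0//; lra.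
Qed.

(** A cost bound [hi] below level s and [lo] above it bound each ratio by K as soon as hi <= K
    lo. *)
Lemma stability_sup_lty (R : realType) (C : set (R -> R))
    (cost : R -> (R -> R) -> \bar R) (seminorm : (R -> R) -> \bar R)
    (lo hi : R -> R -> R) (K : R) : 0 <= K ->
  (forall eps s f, 0 < eps -> 0 < s -> C f ->
    (seminorm f <= s%:E)%E -> (cost eps f <= (hi eps s)%:E)%E) ->
  (forall eps s f, 0 < eps -> 0 < s -> C f ->
    (s%:E <= seminorm f)%E -> ((lo eps s)%:E <= cost eps f)%E) ->
  (forall eps s, 0 < eps -> 0 < s -> hi eps s <= K * lo eps s) ->
  (stability_sup C cost seminorm < +oo)%E.
Proof.
move=> K0 hhi hlo hK; apply: le_lt_trans (ltry K).
apply: ge_ereal_sup => _ [eps [s [eps0 s0 ->]]].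
set num := ereal_sup _; set den := Order.max _ _.
have numle : (num <= (hi eps s)%:E)%E.
  by apply: ge_ereal_sup => _ [f [Cf fs] <-]; exact: hhi.
have den1 : (1 <= den)%E by rewrite le_max lexx.
have denle : ((lo eps s)%:E <= den)%E.
  rewrite le_max; apply/orP; right.
  by apply: le_ereal_inf_tmp => _ [f [Cf fs] <-]; exact: hlo.
move: den1 denle; case: den => [r| |//].
  rewrite !lee_fin => r1 lor; have r0 : 0 < r by exact: lt_le_trans r1.
  rewrite inver gt_eqF// lee_pdivrMr// -EFinM (le_trans numle)// lee_fin.
  by rewrite (le_trans (hK _ _ eps0 s0))// ler_wpM2l.
(* An infinite denominator, as for an empty infimum, gives ratio 0. *)
by rewrite invey mule0 lee_fin.
Qed.

(** * Cost bounds and computational stability *)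

Section AdaptiveCost.
Context {R : realType}.
Implicit Types (tau eps s x y : R) (f : R -> R).

Lemma sqrt_half tau eps x : 0 <= tau -> 0 < eps -> 0 <= x ->
  Num.sqrt (tau * x / (2 * eps)) = 2 * Num.sqrt (tau * x / (8 * eps)).
Proof.
move=> t0 e0 x0.
have -> : tau * x / (2 * eps) = 2 ^+ 2 * (tau * x / (8 * eps)).
  by field; rewrite gt_eqF.
by rewrite sqrtrM ?sqr_ge0// sqrtr_sqr ger0_norm.
Qed.

Lemma sqrt_div_le x y z : 0 < z -> x <= y -> Num.sqrt (x / z) <= Num.sqrt (y / z).
Proof. by move=> z0 xy; rewrite ler_wsqrtr// ler_wpM2r// invr_ge0 ltW. Qed.

Lemma sqrt_slope_le_d2 tau eps f : 0 < tau -> 0 < eps -> W2infty f ->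
  Num.sqrt (tau * fine (norm_slope f) / (2 * eps))
    <= Num.sqrt (tau * fine (norm_d2 f) / (4 * eps)).
Proof.
move=> t0 e0 Wf.
have -> : tau * fine (norm_d2 f) / (4 * eps) =
    tau * (fine (norm_d2 f) / 2) / (2 * eps) by field; rewrite gt_eqF.
apply: sqrt_div_le; first exact: mulr_gt0.
by rewrite ler_pM2l// -lee_fin -norm_slopeE// norm_slope_le_d2.
Qed.

Lemma adaptive_cost_bounds tau eps f : 2 <= tau -> 0 < eps -> cone tau f ->
  let Q := Num.sqrt (tau * fine (norm_slope f) / (8 * eps)) in
  exists M : nat, [/\ adaptive_cost tau eps f = (M%:R + 1)%:E, Q <= M%:R &
    M%:R + 1 <= 2 * Q + tau + 4].
Proof.
move=> tau2 eps0 fc Q.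
have [r [M [ar _ [_ cr] [_ QM] MQ]]] := adaptive_bounds tau2 eps0 fc.
exists M; split => //; last by rewrite /Q; lra.
by rewrite /adaptive_cost ar cr natr1.
Qed.

Lemma stable_slope tau : 2 <= tau ->
  (stability_sup (cone tau) (adaptive_cost tau) norm_slope < +oo)%E.
Proof.
move=> tau2; have tau0 : 0 < tau by exact: lt_le_trans tau2.
pose q eps s := Num.sqrt (tau * s / (8 * eps)).
(* K = tau + 4 works because 2 q + tau + 4 <= (tau + 4) (q + 1). *)
apply: (@stability_sup_lty _ _ _ _ (fun eps s => q eps s + 1)
  (fun eps s => 2 * q eps s + tau + 4) (tau + 4)).
- by lra.
- move=> eps s f e0 s0 fc; rewrite (norm_slopeE (proj1 fc)) lee_fin => fs.
  have [M [-> _ hM]] := adaptive_cost_bounds tau2 e0 fc.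
  have e8 : 0 < 8 * eps by rewrite mulr_gt0.
  have := sqrt_div_le e8 (ler_wpM2l (ltW tau0) fs).
  by rewrite lee_fin /q; lra.
- move=> eps s f e0 s0 fc; rewrite (norm_slopeE (proj1 fc)) lee_fin => fs.
  have [M [-> hM _]] := adaptive_cost_bounds tau2 e0 fc.
  have e8 : 0 < 8 * eps by rewrite mulr_gt0.
  have := sqrt_div_le e8 (ler_wpM2l (ltW tau0) fs).
  by rewrite lee_fin /q; lra.
- move=> eps s _ _; have q0 : 0 <= q eps s by exact: sqrtr_ge0.
  nra.
Qed.

(** The slope bounds are transferred to D: from above by S <= D / 2, from below by D <= tau S. *)
Lemma stable_d2 tau : 2 <= tau ->
  (stability_sup (cone tau) (adaptive_cost tau) norm_d2 < +oo)%E.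
Proof.
move=> tau2; have tau0 : 0 < tau by exact: lt_le_trans tau2.
pose q eps s := Num.sqrt (s / (8 * eps)).
apply: (@stability_sup_lty _ _ _ _ (fun eps s => q eps s + 1)
  (fun eps s => 2 * tau * q eps s + tau + 4) (2 * tau + 4)).
- by lra.
- move=> eps s f e0 s0 fc; have Wf := proj1 fc.
  rewrite norm_d2E// lee_fin => fs.
  have [M [-> _ hM]] := adaptive_cost_bounds tau2 e0 fc.
  rewrite lee_fin (le_trans hM)// -!addrA lerD2r.
  rewrite -sqrt_half ?(ltW tau0) ?fine_ge0 ?Linfty_ge0//.
  rewrite (le_trans (sqrt_slope_le_d2 tau0 e0 Wf))//.
  have e4 : 0 < 4 * eps by rewrite mulr_gt0.
  rewrite (le_trans (sqrt_div_le e4 (ler_wpM2l (ltW tau0) fs)))//.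
  have -> : tau * s / (4 * eps) = 2 * tau * (s / (8 * eps)).
    by field; rewrite gt_eqF.
  (* This gives sqrt (2 tau) <= 2 tau, the coefficient of q in the upper bound. *)
  have t1 : 1 <= 2 * tau by lra.
  rewrite sqrtrM; last by lra.
  rewrite ler_wpM2r ?sqrtr_ge0// sqrtr_le_pos; last by lra.
  by rewrite expr2 ler_peMl//; lra.
- move=> eps s f e0 s0 fc; have Wf := proj1 fc.
  rewrite norm_d2E// lee_fin => fs.
  have [M [-> hM _]] := adaptive_cost_bounds tau2 e0 fc.
  have e8 : 0 < 8 * eps by rewrite mulr_gt0.
  have := sqrt_div_le e8 (le_trans fs (cone_le fc)).
  by rewrite lee_fin /q; lra.
- move=> eps s _ _; have q0 : 0 <= q eps s by exact: sqrtr_ge0.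
  nra.
Qed.

End AdaptiveCost.

Theorem theorem9 (R : realType) :
  (forall sigma : R, 0 < sigma ->
     forall (eps : R) (f : R -> R), 0 < eps -> ball_d2 sigma f ->
       (Linfty (fun x => f x - output (nonadaptive sigma eps f) x)%R
          <= eps%:E)%E /\
       (ncost (nonadaptive sigma eps f))%:Z
         = Num.ceil (Num.sqrt (sigma / (8 * eps))) + 1)
  /\
  (forall tau : R, 2 <= tau ->
     (forall (eps : R) (f : R -> R), 0 < eps -> cone tau f ->
        exists2 r : result, adaptive tau eps f = Some r &
        (Linfty (fun x => f x - output r x)%R <= eps%:E)%E /\
        [/\ Num.max (Num.ceil ((tau + 1) / 2))
                    (Num.ceil (Num.sqrt (fine (norm_d2 f) / (8 * eps)))) + 1
              <= Num.max (Num.ceil ((tau + 1) / 2))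
                         (Num.ceil (Num.sqrt
                            (tau * fine (norm_slope f) / (8 * eps)))) + 1,
            Num.max (Num.ceil ((tau + 1) / 2))
                    (Num.ceil (Num.sqrt
                       (tau * fine (norm_slope f) / (8 * eps)))) + 1
              <= (ncost r)%:Z,
            (ncost r)%:R
              <= Num.sqrt (tau * fine (norm_slope f) / (2 * eps)) + tau + 4 &
            Num.sqrt (tau * fine (norm_slope f) / (2 * eps)) + tau + 4
              <= Num.sqrt (tau * fine (norm_d2 f) / (4 * eps)) + tau + 4])
     /\
     (stability_sup (cone tau) (adaptive_cost tau) norm_slope < +oo)%E
     /\
     (stability_sup (cone tau) (adaptive_cost tau) norm_d2 < +oo)%E).
Proof.
split=> [sigma s0 eps f e0 [Wf fs]|tau tau2].
  have q0 : 0 < Num.sqrt (sigma / (8 * eps)).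
    by rewrite sqrtr_gt0 divr_gt0// mulr_gt0.
  have c0 : (0 < ceiln (Num.sqrt (sigma / (8 * eps))))%N.
    by rewrite ltnNge ceiln_le ?(ltW q0)// -ltNge.
  rewrite norm_d2E// lee_fin in fs.
  rewrite /nonadaptive nonadaptive_nE//=; split.
    by apply: (spline_Linfty Wf e0 c0 fs); exact: ceiln_ge (ltW q0).
  rewrite (@ncost_nodes _ _ _ c0)// -ceilnE ?(ltW q0)//.
  by rewrite intS addrC.
have tau0 : 0 < tau by exact: lt_le_trans tau2.
split; last by split; [exact: stable_slope|exact: stable_d2].
move=> eps f e0 fc; have Wf := proj1 fc.
have [r [M [ar or [M0 cr] [tM QM] MQ]]] := adaptive_bounds tau2 e0 fc.
have e8 : 0 < 8 * eps by rewrite mulr_gt0.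
exists r => //; split.
  by rewrite or; exact: spline_Linfty Wf e0 M0 (cone_le fc) QM.
split.
- rewrite lerD2r ge_max le_max lexx /= le_max; apply/orP; right.
  by apply: le_ceil; apply: sqrt_div_le (cone_le fc).
(* A ceiling is at most the integer M exactly when its argument is. *)
- rewrite cr intS addrC lerD2l ge_max !ceil_le_int.
  by rewrite tM.
- rewrite cr sqrt_half ?(ltW tau0) ?fine_ge0 ?Linfty_ge0// -natr1; lra.
- by rewrite !lerD2r; exact: sqrt_slope_le_d2.
Qed.
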